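(* Let $(\mathcal{A},\cdot,\circ)$ be a Novikov-Poisson algebra such that $(\mathcal{A},\cdot)$ contains an identity element $1$ and $1\circ 1=2$ (i.e. $1\circ1$ is twice the identity element). Then $(\mathcal{A},\cdot,\circ)$ is an NX-bialgebra, with $\cdot$ playing the role of the operation $\times$.
   Context: All vector spaces are over $\mathbb{R}$. A Novikov algebra is a vector space with a bilinear operation $\circ$ satisfying $(x\circ y)\circ z=(x\circ z)\circ y$ and $(x\circ y)\circ z-x\circ (y\circ z)=(y\circ x)\circ z-y\circ (x\circ z)$ for all $x,y,z$. A Novikov-Poisson algebra is a vector space $\mathcal{A}$ with two bilinear operations $\cdot,\circ$ such that $(\mathcal{A},\cdot)$ is a commutative associative algebra (which in general may lack an identity element), $(\mathcal{A},\circ)$ is a Novikov algebra, and for all $x,y,z\in\mathcal{A}$: $(x\cdot y)\circ z=x\cdot (y\circ z)$ and $(x\circ y)\cdot z-x\circ (y\cdot z)=(y\circ x)\cdot z-y\circ (x\cdot z)$. An NX-bialgebra is a vector space $V$ with two bilinear operations $\times,\circ$ such that $(V,\times)$ is a commutative (not necessarily associative) algebra, $(V,\circ)$ is a Novikov algebra, and for all $u,v,w\in V$: $$(u\times v)\circ w=u\times (v\circ w),$$ $$(u\times v)\times w+u\times (v\times w)=(v\circ u)\times w+u\times (v\circ w)-v\circ (u\times w),$$ $$(u\times v)\times w-u\times (v\times w)=(u\times v)\circ w+w\circ (u\times v)-u\circ (v\times w)-(v\times w)\circ u.$$ *)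

(* Defs.v *)
From HB Require Import structures.
From mathcomp Require Import all_boot all_order all_algebra.
From mathcomp Require Import reals.

Set Implicit Arguments.
Unset Strict Implicit.
Unset Printing Implicit Defensive.

Import GRing.Theory.
Local Open Scope ring_scope.

(* Bilinearity of the operations is carried by the type                      *)
(* [{bilinear V -> V -> V}], so the predicates below only record identities. *)

Section NovikovStructures.

Variables (R : realType) (V : lmodType R).

Section Novikov.

Variable circ : {bilinear V -> V -> V}.
Local Notation "x ∘ y" := (circ x y) (at level 40, left associativity).

Record is_Novikov : Prop := IsNovikov {
  Novikov_rcomm : forall x y z, (x ∘ y) ∘ z = (x ∘ z) ∘ y;
  Novikov_lsymm : forall x y z,
    (x ∘ y) ∘ z - x ∘ (y ∘ z) = (y ∘ x) ∘ z - y ∘ (x ∘ z)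
}.

End Novikov.

Section NovikovPoisson.

Variables dot circ : {bilinear V -> V -> V}.
Local Notation "x ⋅ y" := (dot x y) (at level 40, left associativity).
Local Notation "x ∘ y" := (circ x y) (at level 40, left associativity).

Record is_Novikov_Poisson : Prop := IsNovikovPoisson {
  NP_dotC : commutative dot;
  NP_dotA : associative dot;
  NP_Novikov : is_Novikov circ;
  NP_dot_circ : forall x y z, (x ⋅ y) ∘ z = x ⋅ (y ∘ z);
  NP_lsymm : forall x y z,
    (x ∘ y) ⋅ z - x ∘ (y ⋅ z) = (y ∘ x) ⋅ z - y ∘ (x ⋅ z)
}.

End NovikovPoisson.

Section NXBialgebra.

Variables times circ : {bilinear V -> V -> V}.
Local Notation "x × y" := (times x y) (at level 40, left associativity).
Local Notation "x ∘ y" := (circ x y) (at level 40, left associativity).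

Record is_NX_bialgebra : Prop := IsNXBialgebra {
  NX_timesC : commutative times;
  NX_Novikov : is_Novikov circ;
  NX_times_circ : forall u v w, (u × v) ∘ w = u × (v ∘ w);
  NX_times_sum : forall u v w,
    (u × v) × w + u × (v × w) = (v ∘ u) × w + u × (v ∘ w) - v ∘ (u × w);
  NX_times_assoc : forall u v w,
    (u × v) × w - u × (v × w)
    = (u × v) ∘ w + w ∘ (u × v) - u ∘ (v × w) - (v × w) ∘ u
}.

End NXBialgebra.

End NovikovStructures.

(* Main.v *)
Require Import Defs.
From mathcomp Require Import all_boot all_order all_algebra.
From mathcomp Require Import reals.

Import GRing.Theory.
Local Open Scope ring_scope.

(** Since (x . y) o z = x . (y o z), the identity e gives x o y = x . D y with
    D y = e o y.  The compatibility axiom at e, with D e = 2 e, says that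
    D = d + 2 for a derivation d of the commutative associative product, so
    each left multiplication x o _ satisfies the Leibniz rule with the defect
    2 x . y . z ([circ_dotr]).  The second NX identity is this rule read
    backwards.  In the third one the left side is zero by associativity; on the
    right the defects of w o (u . v) and u o (v . w) are equal and cancel, and
    the other terms cancel because u . (v o w) = u . v . D w is symmetric in u
    and v ([dot_circC]). *)

Lemma dot_circC (R : realType) (A : lmodType R)
  (dot circ : {bilinear A -> A -> A})
  (hNP : is_Novikov_Poisson dot circ) (x y z : A) :
  dot x (circ y z) = dot y (circ x z).
Proof. by rewrite -!(NP_dot_circ hNP) (NP_dotC hNP). Qed.

(** Only x = e has to be treated: x o y = x . (e o y), so multiplying that case
    by x gives the rest. *)
Lemma circ_dotr (R : realType) (A : lmodType R)
  (dot circ : {bilinear A -> A -> A})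
  (hNP : is_Novikov_Poisson dot circ)
  (e : A) (hel : left_id e dot) (her : right_id e dot)
  (hcirc : circ e e = 2%:R *: e) (x y z : A) :
  circ x (dot y z)
  = dot (circ x y) z + dot y (circ x z) - 2%:R *: dot (dot x y) z.
Proof.
have circE u v : circ u v = dot u (circ e v).
  by rewrite -(NP_dot_circ hNP) her.
(* The compatibility axiom with the identity as first argument, where the
   products by circ y e = dot y (circ e e) contribute the factor 2. *)
have D_dot : circ e (dot y z)
    = dot (circ e y) z + dot y (circ e z) - 2%:R *: dot y z.
  have := NP_lsymm hNP e y z.
  rewrite hel (circE y e) hcirc linearZr_LR her linearZl_LR (circE y z).
  move=> h; rewrite -addrA -[X in _ + X]opprB -h.
  by rewrite opprB [RHS]addrC subrK.
rewrite circE D_dot linearBr linearDr linearZr_LR /=.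
rewrite !(NP_dotA hNP) -(circE x y) -circE.
by rewrite (NP_dot_circ hNP) (dot_circC _ _ _ _ hNP x).
Qed.

Theorem mainTheorem4 (R : realType) (A : lmodType R)
  (dot circ : {bilinear A -> A -> A})
  (hNP : is_Novikov_Poisson dot circ)
  (e : A) (hel : left_id e dot) (her : right_id e dot)
  (hcirc : circ e e = 2%:R *: e) :
  is_NX_bialgebra dot circ.
Proof.
have dotC := NP_dotC hNP; have dotA := NP_dotA hNP.
have leibniz := circ_dotr _ _ _ _ hNP e hel her hcirc.
have swap := dot_circC _ _ _ _ hNP.
split=> [||| u v w | u v w].
- exact: dotC.
- exact: (NP_Novikov hNP).
- exact: (NP_dot_circ hNP).
- by rewrite leibniz subKr dotA (dotC v u) scaler_nat mulr2n.
- have defectE : dot (dot w u) v = dot (dot u v) w.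
    by rewrite -dotA dotC.
  rewrite dotA subrr !leibniz defectE !(NP_dot_circ hNP).
  rewrite (swap u v w) (dotC (circ w u) v) (swap u w v) (dotC w (circ u v)).
  set a := dot v (circ u w); set b := dot v (circ w u).
  set c := dot (circ u v) w; set d := 2%:R *: _.
  have -> : a + (b + c - d) = b + (c + a - d).
    by rewrite addrA addrCA (addrC a) -addrA.
  by rewrite addrK subrr.
Qed.
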